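(* Let $f=(f_\Lambda)_{\Lambda\in\mathcal{S}_b}$ be a left interval-specification on $(\Omega,\mathcal{F})$ and let $\mathcal{F}_{-\infty}=\bigcap_{k\in\mathbb{Z}}\mathcal{F}_{\le k}$ be the tail $\sigma$-algebra. Then: (a) $\mathcal{G}(f)$ is a convex set. (b) A measure $\mu\in\mathcal{G}(f)$ is extreme in $\mathcal{G}(f)$ if and only if $\mu$ is trivial on $\mathcal{F}_{-\infty}$. (c) Let $\mu\in\mathcal{G}(f)$ and let $\nu$ be a probability measure on $(\Omega,\mathcal{F})$ with $\nu\ll\mu$. Then $\nu\in\mathcal{G}(f)$ if and only if there exists an $\mathcal{F}_{-\infty}$-measurable function $h\ge 0$ such that $\nu=h\mu$. (d) Each $\mu\in\mathcal{G}(f)$ is uniquely determined (within $\mathcal{G}(f)$) by its restriction to $\mathcal{F}_{-\infty}$. (e) Two distinct extreme elements $\mu,\nu$ of $\mathcal{G}(f)$ are mutually singular on $\mathcal{F}_{-\infty}$.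
   Context: Let $(E,\mathcal{E})$ be a measurable space and $\Omega\subset E^{\mathbb{Z}}$ a set of (admissible) configurations, endowed with the $\sigma$-algebra $\mathcal{F}$ which is the restriction to $\Omega$ of the product $\sigma$-algebra. For $\Lambda\subset\mathbb{Z}$, $\mathcal{F}_\Lambda\subset\mathcal{F}$ is the $\sigma$-algebra generated by the coordinates $\omega\mapsto\omega_i$, $i\in\Lambda$; $\mathcal{F}_{\le n}=\mathcal{F}_{]-\infty,n]}$. $\mathcal{S}_b$ is the set of (nonempty) finite intervals of $\mathbb{Z}$; for $\Lambda\in\mathcal{S}_b$, $l_\Lambda=\min\Lambda$, $m_\Lambda=\max\Lambda$, $\Lambda_-=\,]-\infty,l_\Lambda-1]$. A left interval-specification (LIS) on $(\Omega,\mathcal{F})$ is a family $f=\{f_\Lambda\}_{\Lambda\in\mathcal{S}_b}$ of probability kernels $f_\Lambda:\mathcal{F}_{\le m_\Lambda}\times\Omega\to[0,1]$ (so $f_\Lambda(\cdot\mid\omega)$ is a probability measure on $(\Omega,\mathcal{F}_{\le m_\Lambda})$) such that for all $\Lambda\in\mathcal{S}_b$: (a) for each $A\in\mathcal{F}_{\le m_\Lambda}$, $f_\Lambda(A\mid\cdot)$ is $\mathcal{F}_{\Lambda_-}$-measurable; (b) for each $B\in\mathcal{F}_{\Lambda_-}$ and $\omega\in\Omega$, $f_\Lambda(B\mid\omega)=\mathbf{1}_B(\omega)$; (c) for each $\Delta\in\mathcal{S}_b$ with $\Delta\supset\Lambda$, $f_\Delta f_\Lambda=f_\Delta$ on $\mathcal{F}_{\le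 m_\Lambda}$, i.e. $\int\!\int h(\xi)f_\Lambda(d\xi\mid\sigma)f_\Delta(d\sigma\mid\omega)=\int h(\sigma)f_\Delta(d\sigma\mid\omega)$ for each $\mathcal{F}_{\le m_\Lambda}$-measurable $h$ and each $\omega\in\Omega$. A probability measure $\mu$ on $(\Omega,\mathcal{F})$ is consistent with $f$ if $\mu f_\Lambda=\mu$ on $\mathcal{F}_{\le m_\Lambda}$ for every $\Lambda\in\mathcal{S}_b$, where $(\mu f_\Lambda)(A)=\int f_\Lambda(A\mid\omega)\mu(d\omega)$. $\mathcal{G}(f)$ denotes the set of all such measures. A measure is trivial on a $\sigma$-algebra if it gives each of its sets measure $0$ or $1$. *)

(* Defs.v *)
From HB Require Import structures.
From mathcomp Require Import all_boot all_order all_algebra.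
From mathcomp Require Import all_classical all_reals all_analysis.
From mathcomp Require Import measurable_realfun.

Set Implicit Arguments.
Unset Strict Implicit.
Unset Printing Implicit Defensive.

Import Order.TTheory GRing.Theory Num.Theory.
Import numFieldNormedType.Exports.

Local Open Scope classical_set_scope.
Local Open Scope ring_scope.

(* The elements of Omega as a type. A measurableType is pointed, whence the
   proof that Omega is nonempty; there is no probability measure on an empty
   Omega. *)
Definition config (d : measure_display) (E : measurableType d)
  (Omega : set (int -> E)) (Omega0 : Omega !=set0) : Type := set_type Omega.

Section config_pointed.
Context (d : measure_display) (E : measurableType d) (Omega : set (int -> E)).
Variable Omega0 : Omega !=set0.

Let config_point : config Omega0 := SigSub (mem_set (projT2 (cid Omega0))).

HB.instance Definition _ := Choice.copy (config Omega0) (set_type Omega).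
HB.instance Definition _ := isPointed.Build (config Omega0) config_point.

End config_pointed.

Section sigma_algebras.
Context (d : measure_display) (E : measurableType d) (Omega : set (int -> E)).
Variable Omega0 : Omega !=set0.

Definition config_val (w : config Omega0) : int -> E := \val w.

Definition product_cylinders : set (set (int -> E)) :=
  \bigcup_(i in [set: int])
    preimage_set_system setT (fun x : int -> E => x i) measurable.

(* E^Z with the product sigma-algebra *)
Definition productZ := g_sigma_algebraType product_cylinders.

(* Omega with F, the trace of the product sigma-algebra *)
Definition configF :=
  g_sigma_algebra_preimageType (config_val : config Omega0 -> productZ).

Definition cylinders (L : set int) : set (set (config Omega0)) :=
  \bigcup_(i in L)
    preimage_set_system setT (fun w => config_val w i) measurable.

(* F_L *)
Definition sigma_coord (L : set int) : set (set (config Omega0)) :=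
  <<s cylinders L >>.

(* Omega with F_L *)
Definition config_on (L : set int) := g_sigma_algebraType (cylinders L).

Definition upto (n : int) : set int := [set` `]-oo, n]].

Definition tail_sigma : set (set (config Omega0)) :=
  \bigcap_(k in [set: int]) sigma_coord (upto k).

(* Omega with the tail sigma-algebra: tail_sigma already is a sigma-algebra,
   so that generating changes nothing *)
Definition config_tail := g_sigma_algebraType tail_sigma.

End sigma_algebras.

Arguments config_on {d E Omega} Omega0 L.
Arguments configF {d E Omega} Omega0.
Arguments config_tail {d E Omega} Omega0.
Arguments sigma_coord {d E Omega} Omega0 L.
Arguments tail_sigma {d E Omega} Omega0.

(* The nonempty finite intervals of Z, given by their endpoints. *)
Record interval_Z := IntervalZ {
  lmin : int;
  lmax : int;
  lmin_le_lmax : lmin <= lmax }.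

Definition interval_set (L : interval_Z) : set int :=
  [set` `[lmin L, lmax L]].
Coercion interval_set : interval_Z >-> set.

(* L_- = ]-oo, min L - 1] *)
Definition past (L : interval_Z) : set int := upto (lmin L - 1).

Section lis.
Context (d : measure_display) (E : measurableType d) (Omega : set (int -> E)).
Variables (Omega0 : Omega !=set0) (R : realType).
Local Open Scope ereal_scope.

(* That f_L(A | .) is F_{L_-}-measurable for A in F_{<= max L} is part of f_L
   being a kernel from (Omega, F_{L_-}) to (Omega, F_{<= max L}). In the
   consistency f_D f_L = f_D on F_{<= max L}, the test functions h are
   nonnegative, so that all integrals are defined. *)
Record lis := Lis {
  lis_kernel :> forall L : interval_Z,
    R.-pker (config_on Omega0 (past L))
      ~> (config_on Omega0 (upto (lmax L)));
  lis_proper : forall (L : interval_Z) (B : set (config Omega0))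
    (w : config Omega0),
    sigma_coord Omega0 (past L) B ->
    lis_kernel L w B = (\1_B w)%:E;
  lis_consistent : forall (L D : interval_Z),
    (L : set int) `<=` D ->
    forall h : config_on Omega0 (upto (lmax L)) -> \bar R,
      measurable_fun setT h ->
      (forall w, 0 <= h w) ->
      forall w : config Omega0,
        \int[lis_kernel D w]_s \int[lis_kernel L s]_x h x =
        \int[lis_kernel D w]_s h s }.

(* G(f) *)
Definition consistent_measures (f : lis) : set (probability (configF Omega0) R) :=
  [set mu : probability (configF Omega0) R |
     forall (L : interval_Z) (A : set (config Omega0)),
       sigma_coord Omega0 (upto (lmax L)) A ->
       \int[mu]_w f L w A = mu A].

End lis.

Section mixture.
Context (d : measure_display) (T : measurableType d) (R : realType).
Variables (t : {i01 R}) (mu nu : probability T R).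
Local Open Scope ereal_scope.

(* t mu + (1 - t) nu *)
Definition mixture : set T -> \bar R :=
  measure_add (mscale (t%:num%:nng)%R mu) (mscale ((1 - t%:num)%:nng)%R nu).

HB.instance Definition _ := Measure.on mixture.

Let mixture_setT : mixture setT = 1.
Proof.
rewrite /mixture measure_addE.
change (t%:num%:E * mu setT + (1 - t%:num)%:E * nu setT = 1).
by rewrite !probability_setT !mule1 -EFinD addrC subrK.
Qed.

HB.instance Definition _ :=
  Measure_isProbability.Build _ _ _ mixture mixture_setT.

End mixture.

Section measures.
Context (d : measure_display) (T : measurableType d) (R : realType).
Implicit Types (C : set (probability T R)) (mu nu : probability T R).
Local Open Scope ereal_scope.

(* A library measure is a function on all sets, with unspecified values on the
   nonmeasurable ones; equality of measures is equality on measurable sets. *)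
Definition same_measure mu nu := forall A, measurable A -> mu A = nu A.

Definition convex_measures C :=
  forall mu nu (t : {i01 R}), C mu -> C nu -> C (mixture t mu nu).

Definition extreme C mu :=
  C mu /\
  forall (nu1 nu2 : probability T R) (t : {i01 R}),
    C nu1 -> C nu2 -> (0 < t%:num < 1)%R ->
    same_measure mu (mixture t nu1 nu2) ->
    same_measure nu1 mu /\ same_measure nu2 mu.

Definition trivial_on mu (H : set (set T)) :=
  forall A, H A -> mu A = 0 \/ mu A = 1.

Definition mutually_singular_on mu nu (H : set (set T)) :=
  exists A, [/\ H A, mu A = 0 & nu (~` A) = 0].

End measures.

(* Main.v *)
Require Import Defs.
From HB Require Import structures.
From mathcomp Require Import all_boot all_order all_algebra.
From mathcomp Require Import all_classical all_reals all_analysis.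
From mathcomp Require Import measurable_realfun lra.

Set Implicit Arguments.
Unset Strict Implicit.
Unset Printing Implicit Defensive.

Import Order.TTheory GRing.Theory Num.Theory.
Import numFieldNormedType.Exports.

Local Open Scope classical_set_scope.
Local Open Scope ring_scope.
Local Open Scope ereal_scope.

(** Everything rests on one property of a consistent measure [mu]: properness
    lets a factor that only depends on the past of [L] be pulled out of the
    kernel [f L], so that the integral of [g * f_L(A | .)] against [mu] is the
    integral of [g] over [A], for every nonnegative [g] measurable with
    respect to the past of [L] ([consistent_past_integral]). A tail-measurable
    [g] is measurable with respect to every past, so that if [nu = g mu] with
    such a [g], then [nu] is again consistent ([consistent_tail_density]).

    Conversely, let [nu] be consistent and absolutely continuous with respect
    to [mu]. For each [l], take the Radon-Nikodym density [g_l] of [nu] with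
    respect to [mu] on the sigma-algebra of the coordinates before [l]. For a
    set [A] that depends on the coordinates up to [m], apply [f L] with [L =
    [l, m]] to both measures: [nu A] is the integral of [f_L(A | .)] against
    [nu], hence of [g_l * f_L(A | .)] against [mu], hence of [g_l] over [A].
    Letting [m] vary, [g_l] is a density of [nu] on the whole sigma-algebra
    ([past_density]). All [g_l] are therefore equal [mu]-almost everywhere,
    and their upper limit as [l] goes to -oo is a tail-measurable density
    ([tail_density]).

    The rest is formal. Two consistent measures [mu] and [nu] both have tail
    densities with respect to [(mu + nu) / 2]; if they agree on the tail
    sigma-algebra, the two densities are almost everywhere equal, and so are
    the measures ([consistent_tail_inj]). Conditioning [mu] on a tail set of
    measure in ]0, 1[ and on its complement writes [mu] as a proper mixture of
    consistent measures, so an extreme [mu] is trivial on the tail. If [mu] is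
    trivial on the tail, the components of any mixture equal to [mu] vanish on
    its null sets, so agree with it on the tail, so are equal to it. Two
    extreme measures with no separating tail set have the same values 0 and 1
    on the tail, so they coincide. *)

(** * Densities and smaller sigma-algebras *)

Section densities.
Context (d : measure_display) (T : measurableType d) (R : realType).

(** Changing variables is legitimate with the Radon-Nikodym derivative of
    [nu], and [k] is almost everywhere equal to it. *)
Lemma integral_density (mu : {sigma_finite_measure set T -> \bar R})
    (nu : {measure set T -> \bar R}) (k : T -> \bar R) :
  nu setT < +oo -> measurable_fun setT k -> (forall x, 0 <= k x) ->
  (forall A, measurable A -> nu A = \int[mu]_(x in A) k x) ->
  forall (g : T -> \bar R) D, measurable D -> measurable_fun setT g ->
    (forall x, 0 <= g x) ->
    \int[nu]_(x in D) g x = \int[mu]_(x in D) (g x * k x).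
Proof.
move=> nuoo mk k0 nuE g D mD mg g0.
pose nu' : {finite_measure set T -> \bar R} := mfrestr measurableT nuoo.
have nu'E A : nu' A = nu A by rewrite /= /mfrestr /mrestr setIT.
have numu : nu' `<< mu.
  apply/null_content_dominatesP => A mA muA0.
  rewrite /= nu'E nuE// null_set_integral//; exact: measurable_funTS.
have intRN := Radon_Nikodym_SigmaFinite.f_integrable numu.
have RN0 := Radon_Nikodym_SigmaFinite.f_ge0 numu.
have kE : ae_eq mu setT (Radon_Nikodym_SigmaFinite.f nu' mu) k.
  apply: integral_ae_eq => // A _ mA.
  by rewrite -Radon_Nikodym_SigmaFinite.f_integral// nu'E nuE.
have -> : \int[nu]_(x in D) g x = \int[nu']_(x in D) g x.
  by apply: eq_measure_integral => A _ _; exact/esym/nu'E.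
rewrite -(Radon_Nikodym_SigmaFinite.change_of_variables numu)//; last first.
  exact: measurable_funTS.
apply: ge0_ae_eq_integral => //.
- apply: measurable_funTS; apply: emeasurable_funM => //.
  exact: measurable_int intRN.
- by apply: measurable_funTS; exact: emeasurable_funM.
- by move=> x _; rewrite mule_ge0.
- by move=> x _; rewrite mule_ge0.
- by apply: filterS kE => x /= + _ => -> //.
Qed.

(** The integrals of a nonnegative [k] over sets form a measure, so uniqueness
    of measures on a pi-system applies to densities. *)
Lemma density_on_generator (mu : {measure set T -> \bar R})
    (nu : {finite_measure set T -> \bar R}) (k : T -> \bar R)
    (G : set (set T)) :
  measurable_fun setT k -> (forall x, 0 <= k x) ->
  measurable = <<s G >> -> setI_closed G -> G setT ->
  (forall A, G A -> nu A = \int[mu]_(x in A) k x) ->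
  forall A, measurable A -> nu A = \int[mu]_(x in A) k x.
Proof.
move=> mk k0 mG GI GT GE.
pose kmu A := \int[mu]_(x in A) k x.
have kmu0 : kmu set0 = 0 by rewrite /kmu integral_set0.
have kmu_ge0 A : 0 <= kmu A by exact: integral_ge0.
have kmu_sigma : semi_sigma_additive kmu.
  exact: semi_sigma_additive_nng_induced.
pose m : {measure set T -> \bar R} :=
  HB.pack kmu (isMeasure.Build _ _ _ kmu kmu0 kmu_ge0 kmu_sigma).
have nuoo : nu setT < +oo by rewrite ltey_eq fin_num_measure.
move=> A mA.
apply: (measure_unique G (fun=> setT) mG GI (fun=> GT) _ nu m) => //.
by apply: bigcup_const; exists 0%N.
Qed.

End densities.

Section conditioning.
Context (d : measure_display) (T : measurableType d) (R : realType).
Context (d' : measure_display) (T' : measurableType d').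

(** With [phi] the identity from a sigma-algebra to a smaller one, [g \o phi]
    is the density of [nu] restricted to the smaller one. The conclusion is
    about integrals of functions rather than measures of sets because it will
    be used with [k] a kernel evaluated at a set. *)
Lemma sub_density (mu nu : probability T R) (phi : T -> T') :
  measurable_fun setT phi -> nu `<< mu ->
  exists g : T' -> R, [/\ measurable_fun setT g, forall y, (0 <= g y)%R &
    forall k : T' -> \bar R, measurable_fun setT k -> (forall y, 0 <= k y) ->
      \int[nu]_x k (phi x) = \int[mu]_x (k (phi x) * (g (phi x))%:E)].
Proof.
move=> mphi numu.
pose X : {mfun T >-> T'} := HB.pack phi (isMeasurableFun.Build _ _ _ _ _ mphi).
pose mu' : probability T' R := distribution mu X.
pose nu' : probability T' R := distribution nu X.
have numu' : nu' `<< mu'.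
  apply/null_content_dominatesP => A mA muA0.
  have /null_content_dominatesP := numu; apply => //.
  by rewrite -[X in measurable X]setTI; exact (mphi measurableT A mA).
pose g0 := Radon_Nikodym_SigmaFinite.f nu' mu'.
have g0fin := Radon_Nikodym_SigmaFinite.f_fin_num numu'.
have g0_ge0 := Radon_Nikodym_SigmaFinite.f_ge0 numu'.
have mg0 : measurable_fun setT g0.
  exact: measurable_int (Radon_Nikodym_SigmaFinite.f_integrable numu').
exists (fine \o g0); split.
- exact: measurableT_comp.
- by move=> y; exact: fine_ge0.
move=> k mk k0.
transitivity (\int[nu']_y k y).
  by rewrite ge0_integral_pushforward.
rewrite -(Radon_Nikodym_SigmaFinite.change_of_variables numu')//.
rewrite ge0_integral_pushforward//.
- by apply: eq_integral => x _ /=; rewrite fineK.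
- exact: emeasurable_funM.
- by move=> y _; rewrite mule_ge0.
Qed.

(** The hypothesis on [k] says that [k \o phi] is the conditional probability
    of [A] given [phi]; functions of [phi] can then be integrated against it
    as against the indicator of [A], because [k] is the density, with respect
    to the law of [phi], of the image of the restriction of [mu] to [A]. *)
Lemma integral_condprob (mu : probability T R) (phi : T -> T') (A : set T)
    (k : T' -> \bar R) :
  measurable_fun setT phi -> measurable A ->
  measurable_fun setT k -> (forall y, 0 <= k y) ->
  (forall B, measurable B ->
    mu (phi @^-1` B `&` A) = \int[mu]_(x in phi @^-1` B) k (phi x)) ->
  forall g : T' -> \bar R, measurable_fun setT g -> (forall y, 0 <= g y) ->
    \int[mu]_x (g (phi x) * k (phi x)) = \int[mu]_(x in A) g (phi x).
Proof.
move=> mphi mA mk k0 kE g mg g0.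
pose X : {mfun T >-> T'} := HB.pack phi (isMeasurableFun.Build _ _ _ _ _ mphi).
pose mu' : probability T' R := distribution mu X.
have [nu' nu'X] : exists m : {measure set T' -> \bar R},
    m = pushforward (mrestr mu mA) phi :> (set _ -> \bar R).
  by unshelve eexists (pushforward (mrestr mu mA) phi).
have nu'E B : measurable B -> nu' B = \int[mu']_(y in B) k y.
  move=> mB; rewrite nu'X /pushforward /mrestr kE//.
  by rewrite ge0_integral_pushforward//; exact: measurable_funTS.
have nu'oo : nu' setT < +oo.
  rewrite nu'X /pushforward /mrestr preimage_setT setTI.
  by rewrite ltey_eq fin_num_measure.
transitivity (\int[mu']_y (g y * k y)).
  rewrite ge0_integral_pushforward//; first exact: emeasurable_funM.
  by move=> w _; rewrite mule_ge0.
rewrite -(integral_density nu'oo mk _ nu'E)// nu'X.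
rewrite ge0_integral_pushforward// preimage_setT.
have mgphi : measurable_fun setT (g \o phi) by exact: measurableT_comp.
rewrite (@ge0_negligible_integral _ _ _ _ _ (~` A))//; first last.
- by rewrite /= /mrestr setICl measure0.
- by move=> x _; exact: g0.
- exact: measurableC.
rewrite setDE setCK setTI.
by apply: eq_measure_integral => B mB BA; rewrite /= /mrestr setIidl.
Qed.

(** The equality of the integrals is tested only on the smaller sigma-algebra,
    so uniqueness of densities is applied under the law of [phi]; a null set of
    that law pulls back to a null set of [mu]. *)
Lemma ae_eq_density_sub (mu : probability T R) (phi : T -> T')
    (g h : T' -> \bar R) :
  measurable_fun setT phi ->
  measurable_fun setT g -> (forall y, 0 <= g y) ->
  measurable_fun setT h -> (forall y, 0 <= h y) ->
  \int[mu]_x g (phi x) < +oo ->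
  (forall B, measurable B -> \int[mu]_(x in phi @^-1` B) g (phi x) =
                             \int[mu]_(x in phi @^-1` B) h (phi x)) ->
  {ae mu, forall x, g (phi x) = h (phi x)}.
Proof.
move=> mphi mg g0 mh h0 goo ghE.
pose X : {mfun T >-> T'} := HB.pack phi (isMeasurableFun.Build _ _ _ _ _ mphi).
pose mu' : probability T' R := distribution mu X.
have ig : mu'.-integrable setT g.
  apply/integrableP; split => //.
  under eq_integral do rewrite gee0_abs//.
  by rewrite ge0_integral_pushforward.
have [N [mN N0 subN]] : ae_eq mu' setT g h.
  apply: integral_ae_eq => // B _ mB.
  rewrite ge0_integral_pushforward//; last exact: measurable_funTS.
  by rewrite ghE// ge0_integral_pushforward//; exact: measurable_funTS.
exists (phi @^-1` N); split.
- by rewrite -[X in measurable X]setTI; exact (mphi measurableT N mN).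
- exact: N0.
- by move=> x /= ghx; apply: subN => /= /(_ I).
Qed.

End conditioning.

(** * Mixtures *)

Section mixtures.
Context (d : measure_display) (T : measurableType d) (R : realType).
Implicit Types mu nu : probability T R.

Lemma mixtureE (t : {i01 R}) mu nu A :
  mixture t mu nu A = t%:num%:E * mu A + (1 - t%:num)%:E * nu A.
Proof. by rewrite /mixture measure_addE. Qed.

Lemma mixture_eq0 (t : {i01 R}) mu nu A : (0 < t%:num < 1)%R ->
  mixture t mu nu A = 0 -> mu A = 0 /\ nu A = 0.
Proof.
move=> /andP[t0 t1] /eqP; rewrite mixtureE.
rewrite padde_eq0 ?mule_ge0 ?lee_fin ?subr_ge0 ?measure_ge0 ?ltW//.
rewrite !mule_eq0 !eqe subr_eq0 (gt_eqF t0) (gt_eqF t1) /=.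
by move=> /andP[/eqP -> /eqP ->].
Qed.

End mixtures.

(** * Coordinate sigma-algebras and the tail *)

Section coordinates.
Context (d : measure_display) (E : measurableType d) (Omega : set (int -> E)).
Variable Omega0 : Omega !=set0.

Lemma sigma_coordS (L L' : set int) :
  L `<=` L' -> sigma_coord Omega0 L `<=` sigma_coord Omega0 L'.
Proof. by move=> LL'; apply: sub_sigma_algebra2; exact: bigcup_subset. Qed.

Lemma uptoS (m n : int) : (m <= n)%R -> upto m `<=` upto n.
Proof. by move=> mn x; rewrite /upto /= !in_itv /= => /le_trans; apply. Qed.

Lemma configF_measurableE :
  (measurable : set (set (configF Omega0))) = sigma_coord Omega0 setT.
Proof.
transitivity (<<s preimage_set_system setT (@config_val _ _ _ Omega0)
    (@product_cylinders _ E) >>); first by rewrite g_sigma_preimageE.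
congr (<<s _ >>); apply/seteqP; split.
- move=> _ [_ [i _ [B mB <-]] <-]; exists i => //; exists B => //.
  by rewrite !setTI.
- move=> _ [i _ [B mB <-]]; exists ((fun x : int -> E => x i) @^-1` B).
    by exists i => //; exists B => //; rewrite setTI.
  by rewrite !setTI.
Qed.

Lemma sigma_coord_measurable (L : set int) (A : set (configF Omega0)) :
  sigma_coord Omega0 L A -> measurable A.
Proof. by rewrite configF_measurableE; exact: sigma_coordS. Qed.

Lemma measurable_to_config_on (L : set int) :
  measurable_fun setT (fun w : configF Omega0 => w : config_on Omega0 L).
Proof.
by move=> _ A mA; rewrite setTI; exact: (@sigma_coord_measurable L).
Qed.

(** Each coordinate is in some F_(<= n), so these increasing sigma-algebras
    generate F; their union is the pi-system on which measures are
    compared. *)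
Lemma configF_generated : (measurable : set (set (configF Omega0))) =
  <<s \bigcup_n sigma_coord Omega0 (upto n%:Z) >>.
Proof.
apply/seteqP; split.
- rewrite configF_measurableE; apply: sub_sigma_algebra2.
  move=> A [i _ iA]; exists `|i|%N => //.
  apply: sub_sigma_algebra; exists i => //.
  by rewrite /upto /= in_itv /= ler_norm.
- apply: smallest_sub; first exact: sigma_algebra_measurable.
  by move=> A [n _]; exact: sigma_coord_measurable.
Qed.

Lemma bigcup_upto_setI_closed :
  setI_closed (\bigcup_n sigma_coord Omega0 (upto n%:Z)).
Proof.
move=> A B [m _ mA] [n _ nB]; exists (maxn m n) => //.
apply: (@measurableI _ (config_on Omega0 (upto (maxn m n)%:Z))).
- by apply: sigma_coordS mA; apply: uptoS; rewrite lez_nat leq_maxl.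
- by apply: sigma_coordS nB; apply: uptoS; rewrite lez_nat leq_maxr.
Qed.

Lemma config_tail_measurableE :
  (measurable : set (set (config_tail Omega0))) = tail_sigma Omega0.
Proof.
apply: sigma_algebra_id; apply: sigma_algebra_bigcap => k _.
exact: smallest_sigma_algebra.
Qed.

(** The tail as a decreasing intersection along a sequence; the index is
    shifted by one to match the past of an interval that starts at [- n]. *)
Lemma tail_sigmaE (A : set (config Omega0)) : tail_sigma Omega0 A <->
  forall n, sigma_coord Omega0 (upto (- n%:Z - 1)%R) A.
Proof.
split => [tA n|tA k _]; first exact: tA.
apply: sigma_coordS (tA `|k|%N); apply: uptoS.
by rewrite (@le_trans _ _ (- `|k|%:Z)%R) ?gerBl// abszE lerNl -normrN ler_norm.
Qed.

Lemma tail_measurable (A : set (configF Omega0)) :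
  tail_sigma Omega0 A -> measurable A.
Proof. by move=> tA; exact: sigma_coord_measurable (tA 0%R I). Qed.

Lemma tail_sigmaC (A : set (configF Omega0)) :
  tail_sigma Omega0 A -> tail_sigma Omega0 (~` A).
Proof. by move=> tA k _; apply: sigma_algebraC; exact: tA. Qed.

Lemma limn_esup_shift (R : realType) (u : (\bar R)^nat) (n : nat) :
  limn_esup (fun m => u (m + n)%N) = limn_esup u.
Proof.
have esups_shift : esups (fun m => u (m + n)%N) = fun m => esups u (m + n)%N.
  apply/funext => m; rewrite /esups; congr ereal_sup; apply/seteqP; split.
  - by move=> _ [k /= mk <-]; exists (k + n)%N => //=; rewrite leq_add2r.
  - move=> _ [k /= mnk <-]; exists (k - n)%N => /=.
      by rewrite leq_subRL 1?addnC// (leq_trans _ mnk)// leq_addl.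
    by rewrite subnK// (leq_trans _ mnk)// leq_addl.
rewrite !limn_esup_lim esups_shift; apply/cvg_lim => //.
by rewrite (cvg_shiftn n (esups u)); exact: is_cvg_esups.
Qed.

(** Dropping the first [n] functions does not change the upper limit, and the
    remaining ones only depend on the coordinates below [- n]. *)
Lemma measurable_tail_limn_esup (R : realType)
    (g : nat -> config Omega0 -> \bar R) :
  (forall n, measurable_fun setT
    (g n : config_on Omega0 (upto (- n%:Z - 1)%R) -> \bar R)) ->
  measurable_fun setT
    ((fun w => limn_esup (g ^~ w)) : config_tail Omega0 -> \bar R).
Proof.
move=> mg _ B mB; rewrite config_tail_measurableE setTI.
apply/tail_sigmaE => n.
have mlim : measurable_fun setT
    ((fun w => limn_esup (fun m => g (m + n)%N w)) :
       config_on Omega0 (upto (- n%:Z - 1)%R) -> \bar R).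
  apply: measurable_fun_limn_esup => m _ C mC; rewrite setTI.
  apply: (@sigma_coordS (upto (- (m + n)%N%:Z - 1)%R)).
    by apply: uptoS; rewrite lerB// lerN2 lez_nat leq_addl.
  by have := mg (m + n)%N measurableT _ mC; rewrite setTI.
have shiftE : (fun w => limn_esup (fun m => g (m + n)%N w)) =
              (fun w => limn_esup (g ^~ w)).
  by apply/funext => w; rewrite (limn_esup_shift (g ^~ w)).
by move: mlim; rewrite shiftE => /(_ measurableT _ mB); rewrite setTI.
Qed.

End coordinates.

Section measurability_transfer.
Context (d : measure_display) (E : measurableType d) (Omega : set (int -> E)).
Variable Omega0 : Omega !=set0.
Context (d' : measure_display) (Y : measurableType d').

Lemma measurable_fun_configF (L : set int) (h : config Omega0 -> Y) :
  measurable_fun setT (h : config_on Omega0 L -> Y) ->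
  measurable_fun setT (h : configF Omega0 -> Y).
Proof.
by move=> mh; apply: (measurableT_comp mh); exact: measurable_to_config_on.
Qed.

Lemma measurable_fun_tail_upto (k : int) (h : config Omega0 -> Y) :
  measurable_fun setT (h : config_tail Omega0 -> Y) ->
  measurable_fun setT (h : config_on Omega0 (upto k) -> Y).
Proof.
move=> mh _ B mB; have := mh measurableT B mB.
by rewrite config_tail_measurableE; apply.
Qed.

Lemma measurable_fun_tail_configF (h : config Omega0 -> Y) :
  measurable_fun setT (h : config_tail Omega0 -> Y) ->
  measurable_fun setT (h : configF Omega0 -> Y).
Proof.
move=> /(@measurable_fun_tail_upto 0) mh; exact: measurable_fun_configF mh.
Qed.

End measurability_transfer.

(** * Consistent measures and their densities *)

Section consistent.
Context (d : measure_display) (E : measurableType d) (Omega : set (int -> E)).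
Variables (Omega0 : Omega !=set0) (R : realType) (f : lis Omega0 R).
Implicit Types (mu nu : probability (configF Omega0) R) (L : interval_Z).

Lemma past_upto L : past L `<=` upto (lmax L).
Proof.
apply: uptoS; rewrite lerBlDr (le_trans (lmin_le_lmax L))// lerDl.
exact: ler01.
Qed.

(** By properness, [f L w] charges only one of [B] and its complement. *)
Lemma lis_setI_past L (A B : set (config Omega0)) w :
  sigma_coord Omega0 (upto (lmax L)) A -> sigma_coord Omega0 (past L) B ->
  f L w (B `&` A) = (\1_B w)%:E * f L w A.
Proof.
move=> mA pB; have mB := sigma_coordS (@past_upto L) pB.
have pCB : sigma_coord Omega0 (past L) (~` B) by exact: sigma_algebraC.
have mCB := sigma_coordS (@past_upto L) pCB.
have null_sub C D : sigma_coord Omega0 (upto (lmax L)) C ->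
    sigma_coord Omega0 (upto (lmax L)) D -> C `<=` D -> f L w D = 0 ->
    f L w C = 0.
  move=> mC mD CD D0; apply: (@subset_measure0 _ _ _ (f L w) C D) => //.
have mBA : sigma_coord Omega0 (upto (lmax L)) (B `&` A).
  exact: (@measurableI _ (config_on Omega0 (upto (lmax L)))).
rewrite indicE; case: (boolP (w \in B)) => [/set_mem|/negP] wB.
  have DI : f L w A = f L w (A `\` B) + f L w (A `&` B).
    exact: (measureDI (f L w) mA mB).
  have ABC0 : f L w (A `\` B) = 0.
    apply: (null_sub _ (~` B)) => //.
    - exact: (@measurableD _ (config_on Omega0 (upto (lmax L)))).
    - by rewrite (lis_proper f w pCB) indicE memNset.
  by rewrite mul1e DI ABC0 add0e setIC.
rewrite mul0e; apply: (null_sub _ B) => //.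
by rewrite (lis_proper f w pB) indicE; case: (w \in B) wB.
Qed.

Lemma measurable_lis L (A : set (config Omega0)) :
  sigma_coord Omega0 (upto (lmax L)) A ->
  measurable_fun setT (fun w : config_on Omega0 (past L) => f L w A).
Proof. move=> mA; exact: measurable_kernel. Qed.

(** By consistency and [lis_setI_past], [f_L(A | .)] is the conditional
    probability under [mu] of [A] given the past of [L]. *)
Lemma consistent_past_integral mu L (A : set (config Omega0))
    (g : config_on Omega0 (past L) -> \bar R) :
  consistent_measures f mu -> sigma_coord Omega0 (upto (lmax L)) A ->
  measurable_fun setT g -> (forall w, 0 <= g w) ->
  \int[mu]_w (g w * f L w A) = \int[mu]_(w in A) g w.
Proof.
move=> mu_f mA mg g0.
have FA : measurable (A : set (configF Omega0)).
  exact: sigma_coord_measurable mA.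
apply: (integral_condprob (@measurable_to_config_on _ _ _ _ (past L)) FA
  (measurable_lis mA)) => // B pB.
rewrite -(mu_f L); last first.
  apply: (@measurableI _ (config_on Omega0 (upto (lmax L)))) => //.
  exact: sigma_coordS (@past_upto L) _ pB.
rewrite [RHS]integral_mkcond; apply: eq_integral => w _ /=.
by rewrite lis_setI_past// epatch_indic muleC.
Qed.

(** A tail-measurable density is measurable with respect to the past of every
    [L], so [consistent_past_integral] applies to all [L] at once. *)
Lemma consistent_tail_density mu nu (h : config_tail Omega0 -> R) :
  consistent_measures f mu ->
  measurable_fun setT h -> (forall w, (0 <= h w)%R) ->
  (forall A : set (configF Omega0), measurable A ->
    nu A = \int[mu]_(w in A) (h w)%:E) ->
  consistent_measures f nu.
Proof.
move=> mu_f mh h0 nuE L A mA.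
have FA : measurable (A : set (configF Omega0)).
  exact: sigma_coord_measurable mA.
have mhp : measurable_fun setT
    ((fun w => (h w)%:E) : config_on Omega0 (past L) -> \bar R).
  apply/measurable_EFinP.
  exact: (@measurable_fun_tail_upto _ _ _ Omega0 _ _ (lmin L - 1)%R).
have mfA : measurable_fun setT ((fun w => f L w A) : configF Omega0 -> \bar R).
  exact: measurable_fun_configF (measurable_lis mA).
rewrite nuE// -(consistent_past_integral mu_f mA mhp)//.
rewrite (integral_density _ _ _ nuE)//.
- by apply: eq_integral => w _; rewrite muleC.
- by rewrite ltey_eq fin_num_measure.
- exact: measurable_fun_configF mhp.
Qed.

(** The Radon-Nikodym density on the coordinates below [l] already is a
    density on all of F: consistency of both measures on intervals starting at
    [l] propagates it to the later coordinates. *)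
Lemma past_density mu nu (l : int) :
  consistent_measures f mu -> consistent_measures f nu -> nu `<< mu ->
  exists g : config_on Omega0 (upto (l - 1)) -> R,
    [/\ measurable_fun setT g, forall w, (0 <= g w)%R &
        forall A : set (configF Omega0), measurable A ->
          nu A = \int[mu]_(w in A) (g w)%:E].
Proof.
move=> mu_f nu_f numu.
have [g [mg g0 gE]] := sub_density
  (@measurable_to_config_on _ _ _ Omega0 (upto (l - 1))) numu.
exists g; split=> //.
have mEg : measurable_fun setT (EFin \o g) by exact/measurable_EFinP.
apply: (@density_on_generator _ _ _ mu nu (EFin \o g) _ _ _
  (configF_generated Omega0) (@bigcup_upto_setI_closed _ _ _ _)).
- exact: (@measurable_fun_configF _ _ _ _ _ _ _ _ mEg).
- by move=> w; rewrite /= lee_fin.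
- by exists 0%N => //; exact: (@measurableT _ (config_on Omega0 (upto 0))).
move=> A [m _ mA].
(* The maximum with l only serves to make the interval nonempty. *)
have l_le : (l <= Num.max l m%:Z)%R by rewrite le_max lexx.
pose L := IntervalZ l_le.
have mLA : sigma_coord Omega0 (upto (lmax L)) A.
  by apply: sigma_coordS mA; apply: uptoS; rewrite le_max lexx orbT.
transitivity (\int[nu]_w f L w A); first by rewrite nu_f.
rewrite (gE (fun w => f L w A))//; last exact: (measurable_lis mLA).
rewrite -(consistent_past_integral mu_f mLA mEg)//.
by apply: eq_integral => w _; rewrite muleC.
Qed.

(** Densities are unique up to null sets, so the densities measurable with
    respect to the different pasts are almost everywhere equal, also to their
    upper limit, which depends on the tail only. *)
Lemma tail_density mu nu :
  consistent_measures f mu -> consistent_measures f nu -> nu `<< mu ->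
  exists h : config_tail Omega0 -> R,
    [/\ measurable_fun setT h, forall w, (0 <= h w)%R &
        forall A : set (configF Omega0), measurable A ->
          nu A = \int[mu]_(w in A) (h w)%:E].
Proof.
move=> mu_f nu_f numu.
have /all_sig[g gP] : forall n, {g : config Omega0 -> R |
    [/\ measurable_fun setT (g : config_on Omega0 (upto (- n%:Z - 1)%R) -> R),
        forall w, (0 <= g w)%R &
        forall A : set (configF Omega0), measurable A ->
          nu A = \int[mu]_(w in A) (g w)%:E]}.
  by move=> n; apply: cid; exact: (past_density (- n%:Z)%R mu_f nu_f numu).
have mg n : measurable_fun setT ((EFin \o g n) :
    config_on Omega0 (upto (- n%:Z - 1)%R) -> \bar R).
  by have [mgn _ _] := gP n; apply/measurable_EFinP.
have mgF n : measurable_fun setT ((EFin \o g n) : configF Omega0 -> \bar R).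
  exact: measurable_fun_configF (mg n).
have g_ge0 n w : (0 <= g n w)%R by have [_ + _] := gP n; apply.
have gE n A : measurable A -> nu A = \int[mu]_(w in A) (g n w)%:E.
  by have [_ _] := gP n; apply.
have ig n : mu.-integrable setT ((EFin \o g n) : configF Omega0 -> \bar R).
  apply/integrableP; split=> //.
  under eq_integral do rewrite gee0_abs ?lee_fin//.
  by rewrite -gE// ltey_eq fin_num_measure.
have g_ae0 : {ae mu, forall w, forall n, g n w = g 0%N w}.
  apply/ae_foralln => n.
  have : ae_eq mu setT (EFin \o g n) (EFin \o g 0%N).
    by apply: integral_ae_eq => // A _ mA; rewrite -!gE.
  by apply: filterS => w /(_ I) /= [].
(* The absolute value makes h nonnegative everywhere, even where the sequence
   is not constant. *)
pose h (w : config Omega0) : R := `|fine (limn_esup (fun n => (g n w)%:E))|%R.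
have mh : measurable_fun setT (h : config_tail Omega0 -> R).
  apply: measurableT_comp => //; apply: measurableT_comp => //.
  exact: (measurable_tail_limn_esup mg).
have mhF : measurable_fun setT (h : configF Omega0 -> R).
  exact: measurable_fun_tail_configF mh.
have h_ge0 w : (0 <= h w)%R by exact: normr_ge0.
exists h; split=> //.
move=> A mA; rewrite (gE 0%N)//; apply: ge0_ae_eq_integral => //.
- exact: (measurable_funTS (mgF 0%N)).
- by apply/measurable_EFinP; exact: measurable_funTS mhF.
- by move=> w _; rewrite lee_fin.
- by move=> w _; rewrite lee_fin.
move: g_ae0; apply: (@filterS _ _ (ae_filter_ringOfSetsType mu)) => w gw _.
rewrite /h.
have -> : limn_esup (fun n => (g n w)%:E) = (g 0%N w)%:E.
  under eq_fun do rewrite gw.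
  rewrite is_cvg_limn_esupE; last exact: is_cvg_cst.
  by apply/cvg_lim => //; exact: cvg_cst.
by rewrite /= ger0_norm.
Qed.

Lemma consistent_mixture mu nu (t : {i01 R}) :
  consistent_measures f mu -> consistent_measures f nu ->
  consistent_measures f (mixture t mu nu).
Proof.
move=> mu_f nu_f L A mA.
have mfA : measurable_fun setT ((fun w => f L w A) : configF Omega0 -> \bar R).
  exact: measurable_fun_configF (measurable_lis mA).
apply: (etrans _ (esym (mixtureE t mu nu A))).
rewrite /mixture ge0_integral_measure_add//.
by rewrite !ge0_integral_mscale// mu_f// nu_f.
Qed.

(** Half the sum of the two measures is consistent and dominates both, so both
    have tail densities with respect to it; the values on the tail determine
    these densities up to null sets. *)
Lemma consistent_tail_inj mu nu :
  consistent_measures f mu -> consistent_measures f nu ->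
  (forall A, tail_sigma Omega0 A -> mu A = nu A) -> same_measure mu nu.
Proof.
move=> mu_f nu_f munu.
have half_ge0 : (0 <= 2^-1 :> R)%R by lra.
have half_le1 : (2^-1 <= 1 :> R)%R by lra.
pose la := mixture (Itv01 half_ge0 half_le1) mu nu.
have t01 : (0 < (Itv01 half_ge0 half_le1)%:num < 1)%R by rewrite /=; lra.
have la_f : consistent_measures f la by exact: consistent_mixture.
have mu_la : mu `<< la.
  by apply/null_content_dominatesP => A _ /(mixture_eq0 t01)[].
have nu_la : nu `<< la.
  by apply/null_content_dominatesP => A _ /(mixture_eq0 t01)[].
have [g [mg g0 muE]] := tail_density la_f mu_f mu_la.
have [h [mh h0 nuE]] := tail_density la_f nu_f nu_la.
have mgF : measurable_fun setT (g : configF Omega0 -> R).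
  exact: measurable_fun_tail_configF mg.
have mhF : measurable_fun setT (h : configF Omega0 -> R).
  exact: measurable_fun_tail_configF mh.
have mtail : measurable_fun setT
    (fun w : configF Omega0 => w : config_tail Omega0).
  exact: measurable_fun_tail_configF.
have gh : {ae la, forall w : configF Omega0, (g w)%:E = (h w)%:E}.
  apply: (ae_eq_density_sub mtail (g := EFin \o g) (h := EFin \o h)).
  - exact/measurable_EFinP.
  - by move=> w; rewrite /= lee_fin.
  - exact/measurable_EFinP.
  - by move=> w; rewrite /= lee_fin.
  - by rewrite -muE// ltey_eq fin_num_measure.
  move=> B; rewrite config_tail_measurableE => tB.
  have FB := tail_measurable tB.
  by rewrite -muE// -nuE// munu.
move=> A mA; rewrite muE// nuE//; apply: ge0_ae_eq_integral => //.
- by apply/measurable_EFinP; exact: measurable_funTS.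
- by apply/measurable_EFinP; exact: measurable_funTS.
- by move=> w _; rewrite lee_fin.
- by move=> w _; rewrite lee_fin.
- by move: gh; apply: (@filterS _ _ (ae_filter_ringOfSetsType la)) => w ghw _.
Qed.

(** * Extreme consistent measures *)

(** Conditioning on a tail set [A] multiplies [mu] by the tail density [\1_A /
    mu A]. *)
Lemma consistent_conditional mu (A : set (configF Omega0)) :
  consistent_measures f mu -> tail_sigma Omega0 A -> mu A != 0 ->
  exists nu : probability (configF Omega0) R, consistent_measures f nu /\
    forall X, measurable X -> nu X = mu (X `&` A) * ((fine (mu A))^-1)%:E.
Proof.
move=> mu_f tA muA0; have mA := tail_measurable tA.
pose nu : probability (configF Omega0) R := mnormalize (mrestr mu mA) mu.
have nuE X : nu X = mu (X `&` A) * ((fine (mu A))^-1)%:E.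
  rewrite /nu /= /mnormalize /= /mrestr setTI (negbTE muA0) /=.
  by rewrite ifF//; apply/negbTE; rewrite -ltey ltey_eq fin_num_measure.
exists nu; split; last by move=> X _.
have a0 : (0 <= (fine (mu A))^-1)%R by rewrite invr_ge0 fine_ge0.
apply: (consistent_tail_density
  (h := fun w => ((fine (mu A))^-1 * \1_A w)%R) mu_f).
- apply: measurable_funM => //; apply: measurable_indic.
  by rewrite config_tail_measurableE.
- by move=> w; rewrite mulr_ge0// indicE.
move=> X mX; rewrite nuE.
under eq_integral do rewrite EFinM.
rewrite ge0_integralZl_EFin//.
- by rewrite integral_indic// muleC setIC.
- by apply/measurable_EFinP; exact: measurable_indic.
Qed.

(** A tail set [A] with [0 < mu A < 1] would make [mu] the mixture, with
    weight [mu A], of its conditionings on [A] and on its complement. *)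
Lemma extreme_trivial_on_tail mu :
  extreme (consistent_measures f) mu -> trivial_on mu (tail_sigma Omega0).
Proof.
move=> [mu_f ext] A tA; have mA := tail_measurable tA.
have muAfin : mu A \is a fin_num by exact: fin_num_measure.
pose a := fine (mu A); have muAE : mu A = a%:E by rewrite fineK.
have muAC : mu (~` A) = (1 - a)%:E by rewrite probability_setC// muAE.
have [->|muA0] := eqVneq (mu A) 0; first by left.
have [->|muA1] := eqVneq (mu A) 1; first by right.
have a_gt0 : (0 < a)%R by rewrite lt0r fine_ge0// andbT -eqe -muAE.
have a_lt1 : (a < 1)%R.
  by rewrite lt_neqAle -eqe -lee_fin -muAE muA1 probability_le1.
have muAC0 : mu (~` A) != 0 by rewrite muAC eqe subr_eq0 (gt_eqF a_lt1).
have [nu1 [nu1_f nu1E]] := consistent_conditional mu_f tA muA0.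
have [nu2 [nu2_f nu2E]] := consistent_conditional mu_f (tail_sigmaC tA) muAC0.
pose t := Itv01 (ltW a_gt0) (ltW a_lt1).
have t01 : (0 < t%:num < 1)%R by rewrite /= a_gt0.
have mu_mix : same_measure mu (mixture t nu1 nu2).
  move=> X mX; apply: (etrans _ (esym (mixtureE t nu1 nu2 X))).
  rewrite nu1E// nu2E// muAC /= -/a.
  rewrite ![_%:E * (_ * _)]muleCA -!EFinM !mulfV ?mule1 ?subr_eq0 ?gt_eqF//.
  have mAC := measurableC mA.
  rewrite -measureU//; [|exact: measurableI|exact: measurableI|].
    by rewrite -setIUr setUv setIT.
  by rewrite setIACA setICr setI0.
have [nu1_mu _] := ext _ _ _ nu1_f nu2_f t01 mu_mix.
by right; rewrite -nu1_mu// nu1E// setIid muAE -/a -EFinM mulfV ?gt_eqF.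
Qed.

(** On the tail, a null set of [mu] is null for both components of a mixture
    equal to [mu]; by triviality this determines their values there. *)
Lemma trivial_on_tail_extreme mu :
  consistent_measures f mu -> trivial_on mu (tail_sigma Omega0) ->
  extreme (consistent_measures f) mu.
Proof.
move=> mu_f triv; split=> // nu1 nu2 t nu1_f nu2_f t01 mu_mix.
have null A : tail_sigma Omega0 A -> mu A = 0 -> nu1 A = 0 /\ nu2 A = 0.
  by move=> /tail_measurable mA; rewrite mu_mix// => /(mixture_eq0 t01).
have one nu A : measurable A -> nu (~` A) = 0 -> nu A = 1.
  move=> mA; rewrite -{2}(setCK A) (probability_setC nu (measurableC mA)) => ->.
  by rewrite sube0.
have agree A : tail_sigma Omega0 A -> nu1 A = mu A /\ nu2 A = mu A.
  move=> tA; have mA := tail_measurable tA; have [muA0|muA1] := triv _ tA.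
    by rewrite muA0; exact: null.
  have muAC0 : mu (~` A) = 0 by rewrite probability_setC// muA1 subee.
  have [n1 n2] := null _ (tail_sigmaC tA) muAC0.
  by rewrite muA1; split; apply: one.
by split; apply: consistent_tail_inj => // A /agree[].
Qed.

(** Both measures take only the values 0 and 1 on the tail, so a tail set on
    which they differ, or its complement, separates them. *)
Lemma extreme_singular mu nu :
  extreme (consistent_measures f) mu -> extreme (consistent_measures f) nu ->
  ~ same_measure mu nu -> mutually_singular_on mu nu (tail_sigma Omega0).
Proof.
move=> emu enu munu.
have [mu_f _] := emu; have [nu_f _] := enu.
have tmu := extreme_trivial_on_tail emu.
have tnu := extreme_trivial_on_tail enu.
apply: contrapT => nsing; apply: munu; apply: (consistent_tail_inj mu_f nu_f).
move=> A tA; have mA := tail_measurable tA.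
have nuC : nu (~` A) = 1 - nu A by exact: probability_setC.
have muC : mu (~` A) = 1 - mu A by exact: probability_setC.
case: (tmu _ tA) => muA; case: (tnu _ tA) => nuA; rewrite muA nuA//;
  exfalso; apply: nsing.
- by exists A; split; rewrite // nuC nuA subee.
- exists (~` A); split; first exact: tail_sigmaC.
    by rewrite muC muA subee.
  by rewrite setCK.
Qed.

End consistent.

Theorem theorem3p6 (d : measure_display) (E : measurableType d)
    (Omega : set (int -> E)) (Omega0 : Omega !=set0) (R : realType)
    (f : lis Omega0 R) :
  [/\ convex_measures (consistent_measures f),
      forall mu : probability (configF Omega0) R,
        consistent_measures f mu ->
        (extreme (consistent_measures f) mu <->
         trivial_on mu (tail_sigma Omega0)),
      forall mu nu : probability (configF Omega0) R,
        consistent_measures f mu -> nu `<< mu ->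
        (consistent_measures f nu <->
         exists h : config_tail Omega0 -> R,
           [/\ measurable_fun setT h,
               forall w, (0 <= h w)%R &
               forall A : set (configF Omega0), measurable A ->
                 nu A = \int[mu]_(w in A) (h w)%:E]),
      forall mu nu : probability (configF Omega0) R,
        consistent_measures f mu -> consistent_measures f nu ->
        (forall A, tail_sigma Omega0 A -> mu A = nu A) ->
        same_measure mu nu &
      forall mu nu : probability (configF Omega0) R,
        extreme (consistent_measures f) mu ->
        extreme (consistent_measures f) nu -> ~ same_measure mu nu ->
        mutually_singular_on mu nu (tail_sigma Omega0)].
Proof.
split.
- by move=> mu nu t; exact: consistent_mixture.
- move=> mu mu_f; split; first exact: extreme_trivial_on_tail.
  exact: trivial_on_tail_extreme.
- move=> mu nu mu_f numu; split=> [nu_f|[h [mh h0 nuE]]].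
    exact: (tail_density mu_f).
  exact: (consistent_tail_density mu_f mh).
- exact: consistent_tail_inj.
- exact: extreme_singular.
Qed.
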